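(* Fix a type $\tau$. Let $\mathbf{Lat}^-$ be the category of complete lattices whose morphisms are maps preserving $0$, $1$, finite joins and arbitrary meets, $\mathbf{Rel}_\tau$ the category of relational structures of type $\tau$ with $p$-morphisms, and $\mathbf{Alg}_\tau$ the category of bounded lattices with operations $(g_i)_{i\in I}$ of type $\tau$ and homomorphisms (maps preserving $0,1,\wedge,\vee$ and each $g_i$). The assignment $(L,\mathfrak{X})\mapsto L^{\mathfrak{X}-}$, sending $\phi:L\to M$ to $\alpha\mapsto\phi\circ\alpha$ and a $p$-morphism $p:\mathfrak{X}\to\mathfrak{Y}$ to $\beta\mapsto\beta\circ p$ from $L^{\mathfrak{Y}-}$ to $L^{\mathfrak{X}-}$, is a bifunctor $\mathbf{Lat}^-\times\mathbf{Rel}_\tau\to\mathbf{Alg}_\tau$, covariant in the first argument and contravariant in the second. Moreover: $(\prod_J L_j)^{\mathfrak{X}-}\cong\prod_J L_j^{\mathfrak{X}-}$; $L^{(\bigoplus_J\mathfrak{X}_j)-}\cong\prod_J L^{\mathfrak{X}_j-}$; if $\phi$ is one-one (onto) then so is $\alpha\mapsto\phi\circ\alpha$, and conversely when $X$ is nonempty; and if a $p$-morphism $p$ is one-one (onto) then $\beta\mapsto\beta\circ p$ is onto (one-one).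
   Context: A type is $\tau:I\to\mathbb{N}$, $n_i=\tau(i)$. A relational structure of type $\tau$ is $\mathfrak{X}=(X,(S_i)_{i\in I})$ with $S_i\subseteq X^{n_i+1}$. For a complete lattice $L$, the dual convolution algebra $L^{\mathfrak{X}-}$ is the set $L^X$ of functions $X\to L$ with pointwise $\wedge,\vee,0,1$ and operations $g_i(\alpha_1,\ldots,\alpha_{n_i})(x)=\bigwedge\{\alpha_1(x_1)\vee\cdots\vee\alpha_{n_i}(x_{n_i}):(x_1,\ldots,x_{n_i},x)\in S_i\}$ (empty join is $0$). A $p$-morphism $p:(X,(R_i))\to(Y,(S_i))$ is a function $p:X\to Y$ with $\{(y_1,\ldots,y_{n_i}):(y_1,\ldots,y_{n_i},p(x))\in S_i\}=\{(p(x_1),\ldots,p(x_{n_i})):(x_1,\ldots,x_{n_i},x)\in R_i\}$ for all $i$ and $x$. The disjoint union $\bigoplus_J\mathfrak{X}_j$ has universe the disjoint union of the $X_j$ and $i$-th relation the union of the $i$-th relations. *)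

(* Defs.v *)
From HB Require Import structures.
From mathcomp Require Import all_boot all_order.
From mathcomp Require Import all_classical.

Set Implicit Arguments.
Unset Strict Implicit.
Unset Printing Implicit Defensive.

Import Order.TTheory.
Local Open Scope classical_set_scope.
Local Open Scope order_scope.

Record category := Category {
  ob :> Type;
  hom : ob -> ob -> Type;
  cat_id : forall a, hom a a;
  cat_comp : forall a b c, hom b c -> hom a b -> hom a c;
  cat_comp1m : forall a b (f : hom a b), cat_comp (cat_id b) f = f;
  cat_compm1 : forall a b (f : hom a b), cat_comp f (cat_id a) = f;
  cat_compA : forall a b c d (f : hom a b) (g : hom b c) (h : hom c d),
    cat_comp h (cat_comp g f) = cat_comp (cat_comp h g) f }.

Arguments cat_id {_} _.
Arguments cat_comp {_ _ _ _} _ _.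

Definition op_cat (C : category) : category :=
  @Category C (fun a b => hom b a) (fun a => cat_id a)
    (fun a b c g f => cat_comp f g)
    (fun a b f => cat_compm1 f) (fun a b f => cat_comp1m f)
    (fun a b c d f g h => esym (cat_compA h g f)).

Program Definition prod_cat (C D : category) : category :=
  @Category (C * D)%type (fun a b => (hom a.1 b.1 * hom a.2 b.2)%type)
    (fun a => (cat_id a.1, cat_id a.2))
    (fun a b c g f => (cat_comp g.1 f.1, cat_comp g.2 f.2)) _ _ _.
Next Obligation. by move=> C D a b [f g] /=; rewrite !cat_comp1m. Qed.
Next Obligation. by move=> C D a b [f g] /=; rewrite !cat_compm1. Qed.
Next Obligation. by move=> C D a b c d f g h /=; rewrite !cat_compA. Qed.

(* The object map is a parameter, so that the values of a functor on morphisms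
   can be described without transporting along equalities of objects. *)
Record functor (C D : category) (F0 : C -> D) := Functor {
  functor_map : forall a b, hom a b -> hom (F0 a) (F0 b);
  functor_map1 : forall a, functor_map (cat_id a) = cat_id (F0 a);
  functor_mapM : forall a b c (g : hom b c) (f : hom a b),
    functor_map (cat_comp g f) = cat_comp (functor_map g) (functor_map f) }.

Definition isomorphic (C : category) (a b : C) : Prop :=
  exists (f : hom a b) (g : hom b a),
    cat_comp g f = cat_id a /\ cat_comp f g = cat_id b.

(* boolp makes [X -> L] a lattice; it does not provide its bounds. *)
Section FunBounds.
Variables (X : Type) (d : Order.disp_t) (L : tbLatticeType d).

Lemma fun_le0 (f : X -> L) : (fun=> \bot) <= f.
Proof. by apply/asboolP => x; exact: le0x. Qed.

Lemma fun_le1 (f : X -> L) : f <= (fun=> \top).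
Proof. by apply/asboolP => x; exact: lex1. Qed.

HB.instance Definition _ :=
  Order.hasBottom.Build FunOrder.fun_display (X -> L) fun_le0.
HB.instance Definition _ :=
  Order.hasTop.Build FunOrder.fun_display (X -> L) fun_le1.
End FunBounds.

Definition pi_lattice (J : Type) (d : J -> Order.disp_t)
  (L : forall j, tbLatticeType (d j)) : Type := forall j, L j.

Section PiLattice.
Variables (J : Type) (d : J -> Order.disp_t).
Variable L : forall j, tbLatticeType (d j).
Local Notation P := (pi_lattice L).
Implicit Types f g h : P.

HB.instance Definition _ := Choice.copy P (forall j, L j).

Definition pi_le f g := `[< forall j, f j <= g j >].
Definition pi_meet f g : P := fun j => f j `&` g j.
Definition pi_join f g : P := fun j => f j `|` g j.
Definition pi_bot : P := fun=> \bot.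
Definition pi_top : P := fun=> \top.

Lemma pi_ext f g : (forall j, f j = g j) -> f = g.
Proof. exact: functional_extensionality_dep. Qed.

Lemma pi_le_refl : reflexive pi_le.
Proof. by move=> f; apply/asboolP => j. Qed.

Lemma pi_le_anti : antisymmetric pi_le.
Proof.
move=> f g /andP[/asboolP fg /asboolP gf]; apply: pi_ext => j.
by apply: le_anti; rewrite fg gf.
Qed.

Lemma pi_le_trans : transitive pi_le.
Proof.
move=> g f h /asboolP fg /asboolP gh; apply/asboolP => j.
exact: le_trans (fg j) (gh j).
Qed.

HB.instance Definition _ := Order.Le_isPOrder.Build FunOrder.fun_display P
  pi_le_refl pi_le_anti pi_le_trans.

Lemma pi_meetC : commutative pi_meet.
Proof. by move=> f g; apply: pi_ext => j; exact: meetC. Qed.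

Lemma pi_joinC : commutative pi_join.
Proof. by move=> f g; apply: pi_ext => j; exact: joinC. Qed.

Lemma pi_meetA : associative pi_meet.
Proof. by move=> f g h; apply: pi_ext => j; exact: meetA. Qed.

Lemma pi_joinA : associative pi_join.
Proof. by move=> f g h; apply: pi_ext => j; exact: joinA. Qed.

Lemma pi_joinKI g f : pi_meet f (pi_join f g) = f.
Proof. by apply: pi_ext => j; exact: joinKI. Qed.

Lemma pi_meetKU g f : pi_join f (pi_meet f g) = f.
Proof. by apply: pi_ext => j; exact: meetKU. Qed.

Lemma pi_le_meet f g : (f <= g) = (pi_meet f g == f).
Proof.
apply/idP/eqP => [/asboolP fg|<-].
  by apply: pi_ext => j; exact/meet_l/fg.
by apply/asboolP => j; exact: leIr.
Qed.

HB.instance Definition _ := Order.POrder_isLattice.Build FunOrder.fun_display P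
  pi_meetC pi_joinC pi_meetA pi_joinA pi_joinKI pi_meetKU pi_le_meet.

Lemma pi_le0 f : pi_bot <= f.
Proof. by apply/asboolP => j; exact: le0x. Qed.

Lemma pi_le1 f : f <= pi_top.
Proof. by apply/asboolP => j; exact: lex1. Qed.

HB.instance Definition _ := Order.hasBottom.Build FunOrder.fun_display P pi_le0.
HB.instance Definition _ := Order.hasTop.Build FunOrder.fun_display P pi_le1.
End PiLattice.

Definition complete_lattice d (L : tbLatticeType d) : Prop :=
  forall A : set L, infimums A !=set0 /\ supremums A !=set0.

(* In a complete lattice this is the greatest lower bound of every set [A]:
   the library's [infimum] takes its default value on the empty set, and
   the meet of the empty set is the top. *)
Definition bigmeet d (L : tbLatticeType d) (A : set L) : L := infimum \top A.

Record clat := CLat {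
  clat_disp : Order.disp_t;
  clat_sort :> tbLatticeType clat_disp;
  clat_complete : complete_lattice clat_sort }.

Record is_clat_hom (L M : clat) (phi : L -> M) : Prop := IsCLatHom {
  clat_hom0 : phi \bot = \bot;
  clat_hom1 : phi \top = \top;
  clat_homU : Order.join_morphism phi;
  clat_hom_bigmeet : forall A : set L, phi (bigmeet A) = bigmeet (phi @` A) }.

Record clat_hom (L M : clat) := CLatHom {
  clat_fun :> L -> M;
  clat_funP : is_clat_hom clat_fun }.

Lemma clat_homE (L M : clat) (f g : clat_hom L M) :
  clat_fun f = clat_fun g -> f = g.
Proof.
by case: f g => [f fP] [g gP] /= fg; subst g; rewrite (Prop_irrelevance fP gP).
Qed.

Lemma is_clat_hom_id (L : clat) : is_clat_hom (@id L).
Proof. by split=> // A; rewrite image_id. Qed.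

Lemma is_clat_hom_comp (L M N : clat) (g : clat_hom M N) (f : clat_hom L M) :
  is_clat_hom (g \o f).
Proof.
case: g f => [g [g0 g1 gU gI]] [f [f0 f1 fU fI]]; split => /=.
- by rewrite f0.
- by rewrite f1.
- by move=> x y /=; rewrite fU gU.
- by move=> A; rewrite fI gI -image_comp.
Qed.

Program Definition Lat_cat : category :=
  @Category clat clat_hom (fun L => CLatHom (is_clat_hom_id L))
    (fun L M N g f => CLatHom (is_clat_hom_comp g f)) _ _ _.
Next Obligation. by move=> *; exact: clat_homE. Qed.
Next Obligation. by move=> *; exact: clat_homE. Qed.
Next Obligation. by move=> *; exact: clat_homE. Qed.

Lemma pi_complete (J : Type) (L : J -> clat) : complete_lattice (pi_lattice L).
Proof.
move=> A; split.
- have inf j := cid (clat_complete [set f j | f in A]).1.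
  exists (fun j => projT1 (inf j)); split=> [f Af|f fA].
  + apply/asboolP => j; case: (projT2 (inf j)) => lb _.
    by apply: lb; exists f.
  + apply/asboolP => j; case: (projT2 (inf j)) => _; apply=> _ [g Ag <-].
    by move/asboolP: (fA _ Ag); exact.
- have sup j := cid (clat_complete [set f j | f in A]).2.
  exists (fun j => projT1 (sup j)); split=> [f Af|f fA].
  + apply/asboolP => j; case: (projT2 (sup j)) => ub _.
    by apply: ub; exists f.
  + apply/asboolP => j; case: (projT2 (sup j)) => _; apply=> _ [g Ag <-].
    by move/asboolP: (fA _ Ag); exact.
Qed.

Definition clat_prod (J : Type) (L : J -> clat) : clat := CLat (@pi_complete J L).

Section Type_tau.
Variables (I : Type) (tau : I -> nat).

Record rel_struct := RelStruct {
  rel_sort :> Type;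
  rel_of : forall i, set ((tau i).+1.-tuple rel_sort) }.

Arguments rel_of : clear implicits.

(* The tuples (x_1, ..., x_n) such that (x_1, ..., x_n, x) is in S_i. *)
Definition rel_fiber (X : rel_struct) (i : I) (x : X) : set ((tau i).-tuple X) :=
  [set t | rel_of X i (rcons_tuple t x)].

Arguments rel_fiber : clear implicits.

Definition is_pmorphism (X Y : rel_struct) (p : X -> Y) : Prop :=
  forall (i : I) (x : X),
    rel_fiber Y i (p x) = [set map_tuple p t | t in rel_fiber X i x].

Record pmorphism (X Y : rel_struct) := PMorphism {
  pmor_fun :> X -> Y;
  pmor_funP : is_pmorphism pmor_fun }.

Lemma pmorphismE (X Y : rel_struct) (p q : pmorphism X Y) :
  pmor_fun p = pmor_fun q -> p = q.
Proof.
by case: p q => [p pP] [q qP] /= pq; subst q; rewrite (Prop_irrelevance pP qP).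
Qed.

Lemma is_pmorphism_id (X : rel_struct) : is_pmorphism (@id X).
Proof.
move=> i x /=; rewrite -[LHS]image_id; congr (_ @` _).
by apply/funext => t; apply/val_inj; rewrite /= map_id.
Qed.

Lemma is_pmorphism_comp (X Y Z : rel_struct)
  (q : pmorphism Y Z) (p : pmorphism X Y) : is_pmorphism (q \o p).
Proof.
move=> i x /=; rewrite (pmor_funP q) (pmor_funP p) image_comp.
congr (_ @` _); apply/funext => t; apply/val_inj => /=.
by rewrite -map_comp.
Qed.

Program Definition Rel_cat : category :=
  @Category rel_struct pmorphism (fun X => PMorphism (@is_pmorphism_id X))
    (fun X Y Z q p => PMorphism (is_pmorphism_comp q p)) _ _ _.
Next Obligation. by move=> *; exact: pmorphismE. Qed.
Next Obligation. by move=> *; exact: pmorphismE. Qed.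
Next Obligation. by move=> *; exact: pmorphismE. Qed.

Definition rel_sum (J : Type) (X : J -> rel_struct) : rel_struct :=
  @RelStruct {j : J & X j}
    (fun i => \bigcup_j [set map_tuple (existT (fun j => rel_sort (X j)) j) t
                        | t in rel_of (X j) i]).

Record alg := Alg {
  alg_disp : Order.disp_t;
  alg_sort :> tbLatticeType alg_disp;
  alg_op : forall i, (tau i).-tuple alg_sort -> alg_sort }.

Record is_alg_hom (A B : alg) (f : A -> B) : Prop := IsAlgHom {
  alg_hom0 : f \bot = \bot;
  alg_hom1 : f \top = \top;
  alg_homI : Order.meet_morphism f;
  alg_homU : Order.join_morphism f;
  alg_hom_op : forall i (t : (tau i).-tuple A),
    f (alg_op t) = alg_op (map_tuple f t) }.

Record alg_hom (A B : alg) := AlgHom {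
  alg_fun :> A -> B;
  alg_funP : is_alg_hom alg_fun }.

Lemma alg_homE (A B : alg) (f g : alg_hom A B) : alg_fun f = alg_fun g -> f = g.
Proof.
by case: f g => [f fP] [g gP] /= fg; subst g; rewrite (Prop_irrelevance fP gP).
Qed.

Lemma is_alg_hom_id (A : alg) : is_alg_hom (@id A).
Proof.
split=> // i t /=; congr alg_op; apply/val_inj.
by rewrite /= map_id.
Qed.

Lemma is_alg_hom_comp (A B C : alg) (g : alg_hom B C) (f : alg_hom A B) :
  is_alg_hom (g \o f).
Proof.
case: g f => [g [g0 g1 gI gU gop]] [f [f0 f1 fI fU fop]]; split => /=.
- by rewrite f0.
- by rewrite f1.
- by move=> x y /=; rewrite fI gI.
- by move=> x y /=; rewrite fU gU.
- move=> i t; rewrite fop gop; congr alg_op; apply/val_inj => /=.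
  by rewrite -map_comp.
Qed.

Program Definition Alg_cat : category :=
  @Category alg alg_hom (fun A => AlgHom (@is_alg_hom_id A))
    (fun A B C g f => AlgHom (is_alg_hom_comp g f)) _ _ _.
Next Obligation. by move=> *; exact: alg_homE. Qed.
Next Obligation. by move=> *; exact: alg_homE. Qed.
Next Obligation. by move=> *; exact: alg_homE. Qed.

Definition alg_prod (J : Type) (A : J -> alg) : alg :=
  @Alg _ (pi_lattice A)
    (fun i t j => alg_op (map_tuple (fun f : pi_lattice A => f j) t)).

Definition dual_op (L : clat) (X : rel_struct) (i : I)
    (a : (tau i).-tuple (X -> L)) (x : X) : L :=
  bigmeet [set \join_(k < tau i) tnth a k (tnth t k) | t in rel_fiber X i x].

Definition dual_conv (L : clat) (X : rel_struct) : alg :=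
  @Alg _ (X -> L) (@dual_op L X).

End Type_tau.

Arguments rel_of {I tau} r i _.
Arguments rel_fiber {I tau} X i x _.

(* Main.v *)
(* Everything is pointwise: an operation g_i evaluated at a point x is a meet,
   indexed by the fibre of S_i over x, of finite joins. Morphisms of Lat^- commute
   with such expressions, and a p-morphism p is exactly a map under which the fibre
   over p x is the image of the fibre over x. Hence a |-> phi o a o p is a homomorphism
   for every pair (phi, p), which gives the bifunctor. Meets and joins in a product of
   lattices are taken coordinatewise, and a fibre over a point of a disjoint union
   lies in a single summand, so currying gives the two isomorphisms. *)
Require Import Defs.
From mathcomp Require Import all_boot all_order.
From mathcomp Require Import all_classical.

Set Implicit Arguments.
Unset Strict Implicit.
Unset Printing Implicit Defensive.

Import Order.TTheory.
Local Open Scope classical_set_scope.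
Local Open Scope order_scope.

(** * Arbitrary meets and finite joins, also in products *)

Lemma infimums_bigmeet (L : clat) (A : set L) : infimums A (bigmeet A).
Proof.
rewrite /bigmeet /infimum; case: eqP => [->|_].
  by split=> // x _; exact: lex1.
by apply: xgetPex; have [] := clat_complete A.
Qed.

Lemma bigmeet_eq d (L : tbLatticeType d) (A : set L) x :
  infimums A x -> bigmeet A = x.
Proof.
(* For empty [A] the default is [\top]; [x] equals it, because every element is a lower bound of
   [A]. *)
move=> Ax; rewrite /bigmeet /infimum; case: eqP => [A0|_].
  by apply/le_anti; rewrite lex1 andbT; case: Ax => _; apply; rewrite A0.
by apply: xget_subset1 => //; exact: is_subset1_infimums.
Qed.

Lemma bigmeet_set2 d (L : tbLatticeType d) (x y : L) :
  bigmeet [set x; y] = x `&` y.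
Proof.
apply: bigmeet_eq; split=> [z [->|->]|z lb].
- exact: leIl.
- exact: leIr.
- by rewrite lexI; apply/andP; split; apply: lb; [left|right].
Qed.

(** A binary meet is the [bigmeet] of a pair, and [phi] preserves every [bigmeet]. *)
Lemma clat_homI (L M : clat) (phi : clat_hom L M) : Order.meet_morphism phi.
Proof.
by move=> x y; rewrite -!bigmeet_set2 (clat_hom_bigmeet (clat_funP phi))
  image_setU !image_set1.
Qed.

Lemma clat_hom_bigjoin (L M : clat) (phi : clat_hom L M) n (F : 'I_n -> L) :
  phi (\join_(k < n) F k) = \join_(k < n) phi (F k).
Proof.
by apply: big_morph; [exact: clat_homU (clat_funP phi)|
                      exact: clat_hom0 (clat_funP phi)].
Qed.

(** The family of coordinatewise meets is an infimum of [A], and infima are unique. *)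
Lemma pi_bigmeet (J : Type) (L : J -> clat) (A : set (clat_prod L)) j :
  bigmeet A j = bigmeet [set f j | f in A].
Proof.
rewrite (@bigmeet_eq _ (clat_prod L) A (fun j => bigmeet [set f j | f in A])) //.
split=> [f Af|f fA]; apply/asboolP => i.
  by have [+ _] := infimums_bigmeet [set f i | f in A]; apply; exists f.
have [_] := infimums_bigmeet [set f i | f in A]; apply=> _ [g Ag <-].
by have /asboolP := fA _ Ag; exact.
Qed.

Lemma pi_bigjoin (J : Type) (L : J -> clat) n (F : 'I_n -> clat_prod L) j :
  (\join_(k < n) F k) j = \join_(k < n) F k j.
Proof. exact: (big_morph (fun f : clat_prod L => f j)). Qed.

(** * Isomorphisms from bijective homomorphisms *)

Lemma is_alg_hom_can (I : Type) (tau : I -> nat) (A B : alg tau)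
  (f : A -> B) (g : B -> A) :
  is_alg_hom f -> cancel f g -> cancel g f -> is_alg_hom g.
Proof.
case=> f0 f1 fI fU fop fK gK; split.
- by rewrite -f0.
- by rewrite -f1.
- by move=> x y; rewrite -{1}[x]gK -{1}[y]gK -fI fK.
- by move=> x y; rewrite -{1}[x]gK -{1}[y]gK -fU fK.
- move=> i t; rewrite -[RHS]fK fop; congr (g (alg_op _)).
  by apply/eq_from_tnth => k; rewrite !tnth_map gK.
Qed.

Lemma alg_isomorphic (I : Type) (tau : I -> nat) (A B : alg tau)
  (f : A -> B) (g : B -> A) :
  is_alg_hom f -> cancel f g -> cancel g f -> @isomorphic (Alg_cat tau) A B.
Proof.
move=> fP fK gK; exists (AlgHom fP), (AlgHom (is_alg_hom_can fP fK gK)).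
by split; apply: alg_homE; apply/funext => x /=; rewrite ?fK ?gK.
Qed.

Lemma tuple_rconsP n T (t : n.+1.-tuple T) :
  exists (s : n.-tuple T) (x : T), t = rcons_tuple s x.
Proof.
case: t => t; elim/last_ind: t => // t x _ tn.
have tn' : size t == n by rewrite size_rcons in tn.
by exists (Tuple tn'), x; apply/val_inj.
Qed.

(** * The bifunctor and its behaviour on products and disjoint unions *)

Section DualConvolution.
Variables (I : Type) (tau : I -> nat).

Lemma is_alg_hom_dual_conv (L M : clat) (X Y : rel_struct tau)
  (phi : clat_hom L M) (p : pmorphism X Y) :
  @is_alg_hom I tau (dual_conv L Y) (dual_conv M X) (fun a => phi \o a \o p).
Proof.
case: (clat_funP phi) => phi0 phi1 phiU phiI; split.
- by apply/funext => x; exact: phi0.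
- by apply/funext => x; exact: phi1.
- by move=> a b; apply/funext => x; exact: clat_homI.
- by move=> a b; apply/funext => x; exact: phiU.
- move=> i a; apply/funext => x.
  (* Once [phi] is inside the meet and the fibre over [p x] is written as an image, both sides are
     meets over the fibre over [x]. *)
  rewrite /= /dual_op phiI (pmor_funP p) !image_comp; congr bigmeet.
  apply: eq_imagel => t _ /=; rewrite clat_hom_bigjoin.
  by apply: eq_bigr => k _; rewrite !tnth_map.
Qed.

Definition dual_conv_hom (L M : clat) (X Y : rel_struct tau)
    (phi : clat_hom L M) (p : pmorphism X Y) :
    alg_hom (dual_conv L Y) (dual_conv M X) :=
  AlgHom (is_alg_hom_dual_conv phi p).

Program Definition dual_conv_functor :
    @functor (prod_cat Lat_cat (op_cat (Rel_cat tau))) (Alg_cat tau)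
      (fun LX => dual_conv LX.1 LX.2) :=
  @Functor (prod_cat Lat_cat (op_cat (Rel_cat tau))) (Alg_cat tau) _
    (fun LX MY f => dual_conv_hom f.1 f.2) _ _.
Next Obligation. by move=> [L X]; exact: alg_homE. Qed.
Next Obligation. by move=> [L X] [M Y] [N Z] [psi q] [phi p]; exact: alg_homE. Qed.

Lemma dual_conv_prod (J : Type) (L : J -> clat) (X : rel_struct tau) :
  @isomorphic (Alg_cat tau)
    (dual_conv (clat_prod L) X) (alg_prod (fun j => dual_conv (L j) X)).
Proof.
pose f (a : dual_conv (clat_prod L) X) : alg_prod (fun j => dual_conv (L j) X) :=
  fun j x => a x j.
apply: (@alg_isomorphic _ _ _ _ f (fun b x j => b j x)) => //; split=> // i a.
apply: pi_ext => j; apply/funext => x.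
rewrite /f /= /dual_op pi_bigmeet image_comp; congr bigmeet.
apply: eq_imagel => t _ /=; rewrite pi_bigjoin.
by apply: eq_bigr => k _; rewrite !tnth_map.
Qed.

(** A related tuple comes from a single summand, and its last entry [u] determines which one. *)
Lemma rel_fiber_sum (J : Type) (X : J -> rel_struct tau) i (u : rel_sum X) :
  rel_fiber (rel_sum X) i u =
  [set map_tuple (existT (fun j => rel_sort (X j)) (tag u)) t
  | t in rel_fiber (X (tag u)) i (tagged u)].
Proof.
apply/seteqP; split=> [s [j _ [t' + /(congr1 val)/=]]|_ [t rt <-]].
  have [t [y ->]] := tuple_rconsP t'.
  (* Equality of the last entries identifies [u] with [existT _ j y]. *)
  rewrite map_rcons => rt /rcons_inj[/= ts <-].
  by exists t => //; exact/val_inj.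
exists (tag u) => //; exists (rcons_tuple t (tagged u)) => //.
by apply/val_inj; rewrite /= map_rcons; case: u t rt.
Qed.

Lemma dual_conv_sum (J : Type) (L : clat) (X : J -> rel_struct tau) :
  @isomorphic (Alg_cat tau)
    (dual_conv L (rel_sum X)) (alg_prod (fun j => dual_conv L (X j))).
Proof.
pose f (a : dual_conv L (rel_sum X)) : alg_prod (fun j => dual_conv L (X j)) :=
  fun j x => a (existT _ j x).
apply: (@alg_isomorphic _ _ _ _ f (fun b jx => b (tag jx) (tagged jx))) => //.
  split=> // i a; apply: pi_ext => j; apply/funext => x.
  rewrite /f /= /dual_op rel_fiber_sum image_comp; congr bigmeet.
  by apply: eq_imagel => t _ /=; apply: eq_bigr => k _; rewrite !tnth_map.
(* Restricting to the summands and gluing back gives [a] only after the dependent pair is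
   destructed. *)
by move=> a; apply/funext; case.
Qed.

End DualConvolution.

(** * Injectivity and surjectivity of composition maps *)

Lemma comp_inj T U V (g : U -> V) : injective g ->
  injective (fun f : T -> U => g \o f).
Proof. by move=> gI f f' /funeqP eqf; apply/funext => x; exact/gI/eqf. Qed.

Lemma comp_surj T U V (g : U -> V) : set_surj setT setT g ->
  set_surj setT setT (fun f : T -> U => g \o f).
Proof.
move=> gS h _; have /choice[f fP] x : exists u, g u = h x.
  by have [u _ <-] := gS (h x) I; exists u.
by exists f => //; apply/funext => x; exact: fP.
Qed.

(** Constant functions embed [U] into [T -> U], and a point of [T] recovers their values. *)
Lemma comp_inj_inv T U V (g : U -> V) : inhabited T ->
  injective (fun f : T -> U => g \o f) -> injective g.
Proof.
move=> [t] gI x y gxy; have /funeqP/(_ t) // : (fun=> x) = (fun=> y) :> (T -> U).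
by apply: gI; apply/funext => s.
Qed.

Lemma comp_surj_inv T U V (g : U -> V) : inhabited T ->
  set_surj setT setT (fun f : T -> U => g \o f) -> set_surj setT setT g.
Proof.
move=> [t] gS y _; have [f _ /funeqP/(_ t)/= <-] := gS (fun=> y) I.
by exists (f t).
Qed.

Lemma precomp_surj T U V (y0 : V) (p : T -> U) : injective p ->
  set_surj setT setT (fun f : U -> V => f \o p).
Proof.
move=> pI h _.
(* Extend [h] along [p]: on the range of [p] injectivity makes the value well defined, and off it
   [y0] serves. *)
have /choice[f fP] u : exists y : V, forall x, p x = u -> h x = y.
  have [[x <-]|nx] := pselect (exists x, p x = u).
    by exists (h x) => x' /pI ->.
  by exists y0 => x xu; case: nx; exists x.
by exists f => //; apply/funext => x /=; rewrite -(fP _ x).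
Qed.

Lemma precomp_inj T U V (p : T -> U) : set_surj setT setT p ->
  injective (fun f : U -> V => f \o p).
Proof.
move=> pS f f' /funeqP eqf; apply/funext => u.
by have [x _ <-] := pS u I; exact: eqf.
Qed.

Theorem theorem5p5 (I : Type) (tau : I -> nat) :
  (exists F : @functor (prod_cat Lat_cat (op_cat (Rel_cat tau))) (Alg_cat tau)
                (fun LX => dual_conv LX.1 LX.2),
      (forall (L M : clat) (X : rel_struct tau) (phi : clat_hom L M),
          alg_fun (@functor_map _ _ _ F (L, X) (M, X) (phi, @cat_id (Rel_cat tau) X))
          = (fun a : X -> L => phi \o a)) /\
      (forall (L : clat) (X Y : rel_struct tau) (p : pmorphism X Y),
          alg_fun (@functor_map _ _ _ F (L, Y) (L, X) (@cat_id Lat_cat L, p))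
          = (fun b : Y -> L => b \o p))) /\
  (forall (J : Type) (L : J -> clat) (X : rel_struct tau),
      @isomorphic (Alg_cat tau)
        (dual_conv (clat_prod L) X) (alg_prod (fun j => dual_conv (L j) X))) /\
  (forall (J : Type) (L : clat) (X : J -> rel_struct tau),
      @isomorphic (Alg_cat tau)
        (dual_conv L (rel_sum X)) (alg_prod (fun j => dual_conv L (X j)))) /\
  (forall (L M : clat) (X : rel_struct tau) (phi : clat_hom L M),
      let phiX := (fun a : X -> L => phi \o a) in
      [/\ injective phi -> injective phiX,
          set_surj setT setT phi -> set_surj setT setT phiX,
          inhabited X -> injective phiX -> injective phi
        & inhabited X -> set_surj setT setT phiX -> set_surj setT setT phi]) /\
  (forall (L : clat) (X Y : rel_struct tau) (p : pmorphism X Y),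
      let pL := (fun b : Y -> L => b \o p) in
      (injective p -> set_surj setT setT pL) /\
      (set_surj setT setT p -> injective pL)).
Proof.
split; last split; last split; last split.
- by exists (dual_conv_functor tau); split.
- exact: dual_conv_prod.
- exact: dual_conv_sum.
- move=> L M X phi phiX; split.
  + exact: comp_inj.
  + exact: comp_surj.
  + exact: comp_inj_inv.
  + exact: comp_surj_inv.
(* The value [\bot] is the filler outside the range of [p]. *)
- by move=> L X Y p pL; split; [exact: precomp_surj \bot _|exact: precomp_inj].
Qed.
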